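(* If $R$ is a right Noetherian and right small ring, then $R$ is right almost-$QF$.
   Context: Rings are associative with identity; modules are unital right modules. A right $R$-module $M$ is $R$-projective if for every right ideal $I$ of $R$, every homomorphism $M\to R/I$ factors through the canonical projection $R\to R/I$. A ring $R$ is right almost-$QF$ if every injective right $R$-module is $R$-projective. A submodule $K$ of $M$ is superfluous, written $K\ll M$, if $K+L\neq M$ for every proper submodule $L$ of $M$. $R$ is a right small ring if $R_R\ll E(R_R)$, where $E(R_R)$ is the injective hull of $R_R$. *)

(* Defs.v *)
From HB Require Import structures.
From mathcomp Require Import all_boot all_algebra.
From mathcomp Require Import boolp classical_sets.

Set Implicit Arguments.
Unset Strict Implicit.
Unset Printing Implicit Defensive.

Import GRing.Theory.
Local Open Scope ring_scope.
Local Open Scope quotient_scope.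
Local Open Scope classical_set_scope.

(* A right R-module is a left module over the converse ring R^c: for          *)
(* M : rmodType R, the scaling a *: x stands for x a. As rings are pzRingType, *)
(* the zero ring is allowed.                                                  *)
Notation rmodType R := (lmodType R^c).

(* R as a right module over itself: here a *: x is x * a in R, so that a      *)
(* right ideal of R is a submodClosed (rregular R).                           *)
Notation rregular R := ((R^c)^o).

(* A submodule of V is a submodClosed V, i.e. a boolean predicate; this is no *)
(* restriction, since every subset is boolean by the axioms of boolp.         *)
Section Submodules.
Variables (R : pzRingType) (V : lmodType R).
Implicit Types I K L : submodClosed V.

(* {ideal_quot _} expects a zmodClosed predicate, but submodClosed does not record  *)
(* closure under opposite.                                                    *)
Definition submod_pred I : {pred V} := fun x => x \in I.

Lemma submod_pred_zmod_closed I : zmod_closed (submod_pred I).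
Proof.
split=> [|x y xI yI]; rewrite /submod_pred unfold_in ?rpred0 //.
by rewrite rpredD // -scaleN1r rpredZ.
Qed.

HB.instance Definition _ I :=
  GRing.isZmodClosed.Build V (submod_pred I) (submod_pred_zmod_closed I).

(* The quotient module V / I, with canonical projection \pi_(quotmod I). *)
Definition quotmod I : Type := {ideal_quot submod_pred I}.

HB.instance Definition _ I := ZmodQuotient.on (quotmod I).

Definition quotmod_scale I (a : R) := lift_op1 (quotmod I) ( *:%R a).

Lemma pi_quotmod_scale I a :
  {morph \pi_(quotmod I) : x / a *: x >-> quotmod_scale a x}.
Proof.
move=> x; unlock quotmod_scale; apply/eqP.
rewrite piE /Quotient.equiv /submod_pred unfold_in -scalerBr rpredZ //.
have : x - repr (\pi_(quotmod I) x) \in submod_pred I.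
  by rewrite Quotient.idealrBE reprK.
by [].
Qed.

Fact quotmod_scalerA I (a b : R) (x : quotmod I) :
  quotmod_scale a (quotmod_scale b x) = quotmod_scale (a * b) x.
Proof. by rewrite -[x]reprK -!pi_quotmod_scale scalerA. Qed.

Fact quotmod_scale1r I : left_id 1 (@quotmod_scale I).
Proof. by move=> x; rewrite -[x]reprK -pi_quotmod_scale scale1r. Qed.

Fact quotmod_scalerDr I : right_distributive (@quotmod_scale I) +%R.
Proof.
move=> a x y; rewrite -[x]reprK -[y]reprK -!pi_quotmod_scale.
by rewrite -raddfD -pi_quotmod_scale scalerDr raddfD.
Qed.

Fact quotmod_scalerDl I (x : quotmod I) :
  {morph (@quotmod_scale I)^~ x : a b / a + b}.
Proof.
by move=> a b; rewrite -[x]reprK -!pi_quotmod_scale -raddfD scalerDl.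
Qed.

HB.instance Definition _ I := GRing.Zmodule_isLmodule.Build R (quotmod I)
  (@quotmod_scalerA I) (@quotmod_scale1r I) (@quotmod_scalerDr I)
  (@quotmod_scalerDl I).

Fact pi_quotmod_scalable I : scalable \pi_(quotmod I).
Proof. exact: pi_quotmod_scale. Qed.

HB.instance Definition _ I := GRing.isScalable.Build R V (quotmod I) *:%R
  \pi_(quotmod I) (@pi_quotmod_scalable I).

Definition superfluous K : Prop :=
  forall L, (exists x, x \notin L) ->
    ~ (forall x, exists y z, [/\ y \in K, z \in L & x = y + z]).

Definition essential K : Prop :=
  forall L, (exists2 x, x \in L & x != 0) ->
    exists x, [/\ x \in K, x \in L & x != 0].

End Submodules.

Section LinearImage.
Variables (R : pzRingType) (U V : lmodType R) (f : {linear U -> V}).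

Definition lin_image : {pred V} := fun y => y \in range f.

Fact lin_image_submod_closed : submod_closed lin_image.
Proof.
split; first by apply/mem_set; exists 0; rewrite ?linear0.
move=> a _ _ /set_mem[x _ <-] /set_mem[y _ <-].
by apply/mem_set; exists (a *: x + y); rewrite ?linearP.
Qed.

HB.instance Definition _ :=
  GRing.isSubmodClosed.Build R V lin_image lin_image_submod_closed.

End LinearImage.

Definition injective_module (R : pzRingType) (M : lmodType R) : Prop :=
  forall (A B : lmodType R) (i : {linear A -> B}) (g : {linear A -> M}),
    injective i -> exists h : {linear B -> M}, forall x, h (i x) = g x.

(* (E, i) is an injective hull of M, with M identified with its image i(M). *)
Definition injective_hull (R : pzRingType) (M E : lmodType R)
    (i : {linear M -> E}) : Prop :=
  [/\ injective i, essential (lin_image i) & injective_module E].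

Definition right_noetherian (R : pzRingType) : Prop :=
  forall I : nat -> submodClosed (rregular R),
    (forall n, {subset I n <= I n.+1}) ->
    exists n, forall m, (n <= m)%N -> I m =i I n.

(* Injective hulls are unique up to an isomorphism over R, so that it does    *)
(* not matter which one is used for E(R_R).                                   *)
Definition right_small_ring (R : pzRingType) : Prop :=
  exists (E : rmodType R) (i : {linear rregular R -> E}),
    injective_hull i /\ superfluous (lin_image i).

Definition R_projective (R : pzRingType) (M : rmodType R) : Prop :=
  forall (I : submodClosed (rregular R)) (f : {linear M -> quotmod I}),
    exists g : {linear M -> rregular R}, forall x, f x = \pi_(quotmod I) (g x).

Definition right_almost_QF (R : pzRingType) : Prop :=
  forall M : rmodType R, injective_module M -> R_projective M.

(* Main.v *)
Require Import Defs.
From mathcomp Require Import all_boot all_algebra.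
From HB Require Import structures.
From mathcomp Require Import boolp classical_sets.

(** Over a right small ring an injective module M has no maximal submodule.
    Indeed, if N were one and x lay outside N, the map r |-> x r from R to M
    would extend to some h : E(R) -> M; as M = x R + N, the preimage of N under
    h would be a proper submodule of E(R) whose sum with R is E(R), against
    smallness (lemma [small_injective_no_cyclic_supplement], where only
    M = x R + N is assumed of N).

    If R is moreover right Noetherian, a nonzero map f : M -> R / I would
    produce such an N: among the right ideals K for which f(M) is not contained
    in (K + I) / I, the zero ideal being one, take a maximal one; the preimage N
    of (K + I) / I under f satisfies M = x R + N for every x outside N (lemma
    [noetherian_cyclic_supplement]). So every homomorphism from an injective
    module to R / I is zero, and it factors through R as the zero map. *)

Import GRing.Theory.
Local Open Scope ring_scope.
Local Open Scope quotient_scope.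

(** Submodules are boolean predicates; deciding [P] classically lets any closed
    condition define one inside a proof. *)
Definition submod_of (R : pzRingType) (V : lmodType R) (P : V -> Prop)
    (P_closed : submod_closed (fun x => `[< P x >])) : submodClosed V :=
  HB.pack (fun x => `[< P x >])
    (GRing.isSubmodClosed.Build R V (fun x => `[< P x >]) P_closed).

Lemma submod_exists (R : pzRingType) (V : lmodType R) (P : V -> Prop) :
  P 0 -> (forall a x y, P x -> P y -> P (a *: x + y)) ->
  exists K : submodClosed V, forall x, x \in K <-> P x.
Proof.
move=> P0 PD.
have P_closed : submod_closed (fun x => `[< P x >]).
  split; first exact/asboolP.
  by move=> a x y /asboolP Px /asboolP Py; apply/asboolP/PD.
by exists (submod_of _ _ P P_closed) => x; split=> /asboolP.
Qed.

Lemma linear_exists (R : pzRingType) (U V : lmodType R) (f : U -> V) :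
  linear f -> exists g : {linear U -> V}, g =1 f.
Proof.
move=> f_lin.
pose g : {linear U -> V} := HB.pack f (GRing.isLinear.Build R U V *:%R f f_lin).
by exists g.
Qed.

(** Without a maximal member of [P], each member has a strictly larger one, and
    iterating a choice of these gives a chain that never becomes stationary. *)
Lemma right_noetherian_maximal (R : pzRingType)
    (P : submodClosed (rregular R) -> Prop) :
  right_noetherian R -> (exists K, P K) ->
  exists2 K, P K & forall K', P K' -> {subset K <= K'} -> {subset K' <= K}.
Proof.
move=> noethR [K0 PK0]; apply: contrapT => no_max.
have larger (K : {K | P K}) :
    exists K' : {K | P K},
      {subset sval K <= sval K'} /\ ~ {subset sval K' <= sval K}.
  apply: contrapT => noK'; apply: no_max; exists (sval K); first exact: svalP.
  move=> K' PK' sKK'; apply: contrapT => nsK'K.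
  by apply: noK'; exists (exist _ K' PK').
have [next nextP] := choice larger.
pose chain n := sval (iter n next (exist _ K0 PK0)).
have chain_incr n : {subset chain n <= chain n.+1}.
  exact: (nextP (iter n next _)).1.
have [n n_stable] := noethR chain chain_incr.
apply: (nextP (iter n next (exist _ K0 PK0))).2 => r.
by rewrite -/(chain n) -(n_stable n.+1 (leqnSn n)).
Qed.

Lemma adjoin_submod (R : pzRingType) (V : lmodType R) (K : submodClosed V)
    (y : V) :
  exists K' : submodClosed V,
    forall z, z \in K' <-> exists2 a, a \in K & exists r, z = a + r *: y.
Proof.
apply: submod_exists => [|c _ _ [a Ka [r ->]] [b Kb [s ->]]].
  by exists 0; rewrite ?rpred0 //; exists 0; rewrite scale0r addr0.
exists (c *: a + b); first by rewrite rpredD ?rpredZ.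
by exists (c * r + s); rewrite scalerDr scalerDl scalerA addrACA.
Qed.

(** If K is maximal with f(M) not inside its image in R / I, and x in M is not
    sent into that image, lift f(x) to y in R: then K + y R is larger than K, so
    f(M) lies in the image of K + y R, which means that M is x R plus the
    preimage of the image of K. *)
Lemma noetherian_cyclic_supplement (R : pzRingType) (M : rmodType R)
    (I : submodClosed (rregular R)) (f : {linear M -> quotmod I}) :
  right_noetherian R -> (exists m, f m != 0) ->
  exists (N : submodClosed M) (x : M),
    x \notin N /\ forall m, exists r, m - r *: x \in N.
Proof.
move=> noethR [m0 fm0].
pose inim (K : submodClosed (rregular R)) m :=
  exists2 k, k \in K & f m = \pi_(quotmod I) k.
have [||K [x xnK] maxK] :=
  right_noetherian_maximal R (fun K => exists m, ~ inim K m) => //.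
  have [|a u v -> ->|Z memZ] := @submod_exists _ (rregular R) (fun r => r = 0).
  - by [].
  - by rewrite scaler0 addr0.
  exists Z; exists m0 => -[k /memZ-> fm00].
  by rewrite fm00 raddf0 eqxx in fm0.
have [|c u v [a Ka fu] [b Kb fv]|N memN] := @submod_exists _ M (inim K).
- by exists 0; rewrite ?rpred0 // !raddf0.
- exists (c *: a + b); first by rewrite rpredD ?rpredZ.
  by rewrite !linearP fu fv.
exists N, x; split; first by apply/negP => /memN.
pose y : rregular R := repr (f x).
have fx : f x = \pi_(quotmod I) y by rewrite /y reprK.
have [K' memK'] := adjoin_submod _ _ K y.
have KK' : {subset K <= K'}.
  by move=> a Ka; apply/memK'; exists a => //; exists 0; rewrite scale0r addr0.
have yK' : y \in K'.
  by apply/memK'; exists 0; rewrite ?rpred0 //; exists 1; rewrite scale1r add0r.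
have ynK : y \notin K by apply/negP => Ky; apply: xnK; exists y.
move=> m; have [k /memK'[a Ka [r ->]] fm] : inim K' m.
  apply: contrapT => mnK'; move/negP: ynK; apply.
  by apply: maxK yK' => //; exists m.
exists r; apply/memN; exists a => //.
by rewrite raddfB /= linearZ /= fm fx raddfD /= linearZ addrK.
Qed.

(** With h : E(R) -> M extending r |-> x r, and L the preimage of [N] under h,
    write h(e) = x r + n with n in [N]: then e - i(r) lies in L, so that
    E(R) = i(R) + L. Smallness forces L = E(R), hence x = h(i(1)) is in [N]. *)
Lemma small_injective_no_cyclic_supplement (R : pzRingType) (M : rmodType R)
    (N : submodClosed M) (x : M) :
  right_small_ring R -> injective_module M ->
  (forall m, exists r, m - r *: x \in N) -> x \in N.
Proof.
move=> [E [i [[inj_i _ _] small_i]]] injM xN; apply: contrapT => xnN.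
have [|g gE] := @linear_exists _ (rregular R) M (fun r => r *: x).
  by move=> a u v; rewrite scalerDl scalerA.
have [h hi] := injM _ _ i g inj_i.
have [|c u v uN vN|L memL] := @submod_exists _ E (fun e => h e \in N).
- by rewrite raddf0 rpred0.
- by rewrite linearP rpredD ?rpredZ.
apply: (small_i L).
  exists (i 1); apply/negP => /memL.
  by rewrite hi gE scale1r.
move=> e; have [r erN] := xN (h e).
exists (i r), (e - i r); split; last by rewrite addrC subrK.
- by apply/mem_set; exists r.
- by apply/memL; rewrite raddfB /= hi gE.
Qed.

Theorem proposition15 (R : pzRingType) :
  right_noetherian R -> right_small_ring R -> right_almost_QF R.
Proof.
move=> noethR smallR M injM I f.
suff f0 m : f m = 0.
  have [|g gE] := @linear_exists _ M (rregular R) (fun=> 0).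
    by move=> a u v; rewrite scaler0 addr0.
  by exists g => m; rewrite gE f0 raddf0.
apply/eqP; apply: contrapT => /negP fm.
have [|N [x [xnN xN]]] := noetherian_cyclic_supplement R M I f noethR.
  by exists m.
move/negP: xnN; apply.
exact: small_injective_no_cyclic_supplement smallR injM xN.
Qed.
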